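(* Let $k \geq 1$ be an integer. For each positive integer $d$, let $C_2(k,d)$ be the sharp constant in the inequality $$\sum_{n \in \mathbb{Z}^d} |\Delta^k u(n)|^2 \geq C_2(k, d) \sum_{n \in \mathbb{Z}^d} \frac{|u(n)|^2}{|n|^{4k}},\qquad u \in C_c(\mathbb{Z}^d),\ u(0)=0,$$ i.e. the largest constant for which this inequality holds for all $u\in C_c(\mathbb{Z}^d)$ with $u(0)=0$. Then $C_2(k, d) \sim d^{2k}$ as $d \to \infty$; that is, there exist positive constants $c_1, c_2$ and $N$, independent of $d$, such that $c_1 d^{2k}\leq C_2(k,d) \leq c_2 d^{2k}$ for all $d\geq N$.
   Context: $C_c(\mathbb{Z}^d)$ denotes the space of finitely supported (complex-valued) functions on $\mathbb{Z}^d$; $|n|$ is the Euclidean norm of $n \in \mathbb{Z}^d$; $e_j$ is the $j$-th canonical basis vector of $\mathbb{R}^d$. The discrete Laplacian is $\Delta u(n) := \sum_{j=1}^d \big(2u(n)-u(n-e_j)-u(n+e_j)\big)$, and $\Delta^k$ is its $k$-fold composition. Since $u(0)=0$, the term $n=0$ in the sum weighted by a negative power of $|n|$ is understood to be $0$. *)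

(* Defs.v *)
From HB Require Import structures.
From mathcomp Require Import all_boot all_order all_algebra.
From mathcomp Require Import all_classical all_reals.
From mathcomp Require Import complex.
Set Implicit Arguments.
Unset Strict Implicit.
Unset Printing Implicit Defensive.
Import Order.TTheory GRing.Theory Num.Theory.
Local Open Scope classical_set_scope.
Local Open Scope ring_scope.

Definition finitely_supported (R : realType) (d : nat)
    (u : 'rV[int]_d -> R[i]) : Prop :=
  finite_set [set n | u n != 0].

Definition lap (R : realType) (d : nat) (u : 'rV[int]_d -> R[i]) :
    'rV[int]_d -> R[i] :=
  fun n => \sum_(j < d)
    (2 * u n - u (n - delta_mx 0 j) - u (n + delta_mx 0 j)).

Definition iter_lap (R : realType) (d k : nat) (u : 'rV[int]_d -> R[i]) :
    'rV[int]_d -> R[i] :=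
  iter k (@lap R d) u.

Definition enorm (R : realType) (d : nat) (n : 'rV[int]_d) : R :=
  Num.sqrt (\sum_(j < d) ((n 0 j)%:~R : R) ^+ 2).

(* [Normc.normc] is the modulus with values in [R] instead of [R[i]]. *)
Definition lap_energy (R : realType) (k d : nat) (u : 'rV[int]_d -> R[i]) : R :=
  \sum_(n \in [set: 'rV[int]_d]) Normc.normc (iter_lap k u n) ^+ 2.

(* At [n = 0] the quotient is [_ / 0 = 0] as soon as [0 < k]. *)
Definition weighted_norm (R : realType) (k d : nat)
    (u : 'rV[int]_d -> R[i]) : R :=
  \sum_(n \in [set: 'rV[int]_d])
    Normc.normc (u n) ^+ 2 / enorm R n ^+ (4 * k).

Definition hardy_rellich (R : realType) (k d : nat) (C : R) : Prop :=
  forall u : 'rV[int]_d -> R[i], finitely_supported u -> u 0 = 0 ->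
    lap_energy k u >= C * weighted_norm k u.

(* For [0 < d] this is a maximum: see [sharp_const_max]. *)
Definition sharp_const (R : realType) (k d : nat) : R :=
  sup [set C : R | hardy_rellich k d C].

(* A finitely supported sum over an infinite support is [0] by convention; the
   next three lemmas show that this never happens above. *)
Lemma finitely_supported_lap (R : realType) (d : nat)
    (u : 'rV[int]_d -> R[i]) :
  finitely_supported u -> finitely_supported (lap u).
Proof.
move=> fu; rewrite /finitely_supported.
pose S := [set n | u n != 0].
apply: (@sub_finite_set _ _ (S `|` \bigcup_(j in [set: 'I_d])
  ((fun n => n + delta_mx 0 j) @` S `|` (fun n => n - delta_mx 0 j) @` S))).
  move=> n /= lun; apply: contrapT => nS; move/eqP: lun; apply.
  rewrite /lap big1// => j _.
  have nu : u n = 0.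
    by apply/eqP; apply: contrapT => /negP h; apply: nS; left.
  have nm : u (n - delta_mx 0 j) = 0.
    apply/eqP; apply: contrapT => /negP h; apply: nS; right.
    by exists j => //; left; exists (n - delta_mx 0 j) => //; rewrite subrK.
  have np : u (n + delta_mx 0 j) = 0.
    apply/eqP; apply: contrapT => /negP h; apply: nS; right.
    by exists j => //; right; exists (n + delta_mx 0 j) => //; rewrite addrK.
  by rewrite nu nm np mulr0 !subr0.
rewrite finite_setU; split=> //; apply: bigcup_finite => // j _.
by rewrite finite_setU; split; apply: finite_image.
Qed.

Lemma finite_support_lap_energy (R : realType) (k d : nat)
    (u : 'rV[int]_d -> R[i]) : finitely_supported u ->
  finite_set [set n | Normc.normc (iter_lap k u n) ^+ 2 != 0].
Proof.
move=> fu.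
have : finitely_supported (iter_lap k u).
  by elim: k => [//|k IH]; apply: finitely_supported_lap.
apply: sub_finite_set => n /=; apply: contra => /eqP ->.
by rewrite Normc.normc0 expr0n.
Qed.

Lemma finite_support_weighted_norm (R : realType) (k d : nat)
    (u : 'rV[int]_d -> R[i]) : finitely_supported u ->
  finite_set [set n | Normc.normc (u n) ^+ 2 / enorm R n ^+ (4 * k) != 0].
Proof.
apply: sub_finite_set => n /=; apply: contra => /eqP ->.
by rewrite Normc.normc0 expr0n mul0r.
Qed.

Lemma lap_energy_ge0 (R : realType) (k d : nat) (u : 'rV[int]_d -> R[i]) :
  0 <= lap_energy k u.
Proof. by apply: fsumr_ge0 => n _; apply: sqr_ge0. Qed.

Lemma weighted_norm_ge0 (R : realType) (k d : nat) (u : 'rV[int]_d -> R[i]) :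
  0 <= weighted_norm k u.
Proof.
apply: fsumr_ge0 => n _; rewrite divr_ge0 ?sqr_ge0// exprn_ge0//.
exact: sqrtr_ge0.
Qed.

Lemma sharp_const_max (R : realType) (k d : nat) : (0 < d)%N ->
  hardy_rellich k d (sharp_const R k d) /\
  forall C : R, hardy_rellich k d C -> C <= sharp_const R k d.
Proof.
case: d => // d _.
pose e : 'rV[int]_d.+1 := delta_mx 0 0.
pose u0 (n : 'rV[int]_d.+1) : R[i] := if n == e then 1 else 0.
have u0E n : n != e -> u0 n = 0 by rewrite /u0 => /negbTE ->.
have e0 : 0 != e.
  by apply/eqP => /matrixP /(_ 0 0); rewrite !mxE.
have fu0 : finitely_supported u0.
  apply: (@sub_finite_set _ _ [set e]) => [n /=|]; last exact: finite_set1.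
  by move=> n0; apply/eqP; apply: contraNT n0 => /u0E ->.
have ee : enorm R e = 1.
  rewrite /enorm (bigD1 0)//= big1 => [|j /negbTE j0].
    by rewrite mxE !eqxx addr0 expr1n sqrtr1.
  by rewrite mxE j0 andbF expr0n.
have w0 : weighted_norm k u0 = 1.
  rewrite /weighted_norm -(fsbig_widen [set e])// => [|n [_ /= /eqP ne]].
    by rewrite fsbig_set1 ee /u0 eqxx Normc.normc1 !expr1n divr1.
  by rewrite u0E// Normc.normc0 expr0n mul0r.
have ub : has_ubound [set C : R | hardy_rellich k d.+1 C].
  exists (lap_energy k u0) => C /= /(_ u0 fu0 (u0E _ e0)).
  by rewrite w0 mulr1.
have ne : [set C : R | hardy_rellich k d.+1 C] !=set0.
  by exists 0 => u _ _; rewrite mul0r lap_energy_ge0.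
split=> [u fu uz|C hC]; last exact: ub_le_sup.
have := weighted_norm_ge0 k u; rewrite le_eqVlt => /predU1P[<-|w_gt0].
  by rewrite mulr0 lap_energy_ge0.
rewrite -ler_pdivlMr//; apply: ge_sup => // C hC.
by rewrite ler_pdivlMr//; apply: hC.
Qed.

(* Main.v *)
Require Import Defs.
From mathcomp Require Import all_boot all_order all_algebra.
From mathcomp Require Import all_classical all_reals.
From mathcomp Require Import complex ring lra.
Set Implicit Arguments.
Unset Strict Implicit.
Unset Printing Implicit Defensive.
Import Order.TTheory GRing.Theory Num.Theory.
Local Open Scope classical_set_scope.
Local Open Scope ring_scope.

(** The lower bound uses the weights [w = 1 / (s + |n|^2)], where the shift
    [s] depends on [k] only. The shift costs a constant factor, because
    [s + |n|^2 <= (s + 1) |n|^2] for [n <> 0], and it makes the origin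
    harmless.

    The whole dimension dependence comes from one pointwise fact: for every
    exponent [p > 0], if [s] and [d] are large in terms of [p], then
    [g = w ^ p] satisfies [Lap g >= d w g] on all of the lattice
    ([weight_superharmonic]). In the continuum [-Laplace |x|^(-2p)] is
    [2p (d - 2p - 2) |x|^(-2p-2)], which is of order [d] for fixed [p]; here
    the same happens because each of the [d] coordinate directions contributes
    about [2p w g], and the second order errors add up to
    [O(d w^2 + w^2 |n|^2) g], which is small against [d w g].

    Combined with the convexity inequality
    [Lap |u|^2 <= 2 |u| |Lap u|] ([kato]) and the symmetry of [Lap]
    ([green_identity]), this gives, for [p = 2a + 1],
      [2 sum g |u| |Lap u| >= sum g Lap |u|^2 = sum |u|^2 Lap g
         >= d sum w^(2a+2) |u|^2],
    and the Cauchy-Schwarz inequality on the left turns it into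
      [sum w^(2a) |Lap u|^2 >= (d/2)^2 sum w^(2a+2) |u|^2]
    ([weighted_rellich]). For [a = 0, 1, ..., k - 1], apply this to
    [Lap^(k-1-a) u]: each step trades one Laplacian for a factor [(d/2)^2] and
    two powers of the weight, and the chain of the [k] inequalities is the
    desired bound with a constant of order [d^(2k)] ([hardy_rellich_lower]).

    For the upper bound, the test function is the indicator of a basis vector,
    where the weight is [1]. The Laplacian has norm [O(d)] on square summable
    functions ([lap_l2_bound]), so the energy of the [k]-th power on this
    function is [O(d^(2k))]. *)

(** * Sums of finitely supported functions *)

Definition fsupp (T : choiceType) (V : nmodType) (f : T -> V) : Prop :=
  finite_set [set x | f x != 0].

Section FiniteSums.
Variables (R : realType) (T : choiceType).
Implicit Types f g : T -> R.

Lemma fsupp_sub (V W : nmodType) (f : T -> V) (h : T -> W) :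
  fsupp f -> (forall x, f x = 0 -> h x = 0) -> fsupp h.
Proof.
move=> ff fh; apply: sub_finite_set ff => x /=.
by apply: contra_neq; apply: fh.
Qed.

Lemma fsuppD f g : fsupp f -> fsupp g -> fsupp (fun x => f x + g x).
Proof.
move=> ff fg.
apply: (@sub_finite_set _ _ ([set x | f x != 0] `|` [set x | g x != 0])).
  move=> x /=; have [->|] := eqVneq (f x) 0; last by left.
  by rewrite add0r; right.
by rewrite finite_setU.
Qed.

Lemma fsupp_sum (I : finType) (F : I -> T -> R) :
  (forall i, fsupp (F i)) -> fsupp (fun x => \sum_i F i x).
Proof.
move=> fF; apply: (@sub_finite_set _ _ (\bigcup_i [set x | F i x != 0])).
  move=> x /=; apply: contraPP => nF.
  rewrite big1 ?eqxx// => i _; apply/eqP/negP => /negP Fi.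
  by apply: nF; exists i.
by apply: bigcup_finite => // i _; apply: fF.
Qed.

Lemma fsumE f (A : set T) : finite_set A -> [set x | f x != 0] `<=` A ->
  \sum_(x \in [set: T]) f x = \sum_(x \in A) f x.
Proof.
move=> fA fAs; rewrite -(fsbig_widen A)// => x [_ /= nA].
by apply/eqP; apply: contrapT => /negP h; apply: nA; apply: fAs.
Qed.

Lemma fsumD f g : fsupp f -> fsupp g ->
  \sum_(x \in [set: T]) (f x + g x) =
  \sum_(x \in [set: T]) f x + \sum_(x \in [set: T]) g x.
Proof.
move=> ff fg; pose A := [set x | f x != 0] `|` [set x | g x != 0].
have fA : finite_set A by rewrite finite_setU.
rewrite !(@fsumE _ A)//; first by rewrite fsbig_split.
- by move=> x; right.
- by move=> x; left.
- move=> x /=; have [->|] := eqVneq (f x) 0; last by left.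
  by rewrite add0r; right.
Qed.

Lemma fsumN f : \sum_(x \in [set: T]) - f x = - \sum_(x \in [set: T]) f x.
Proof.
by rewrite -mulN1r mulr_fsumr; apply: eq_fsbigr => x _; rewrite mulN1r.
Qed.

Lemma fsum_sum (I : finType) (F : I -> T -> R) : (forall i, fsupp (F i)) ->
  \sum_(x \in [set: T]) (\sum_i F i x) = \sum_i \sum_(x \in [set: T]) F i x.
Proof.
move=> fF; pose A := \bigcup_i [set x | F i x != 0].
have fA : finite_set A by apply: bigcup_finite => // i _; apply: fF.
rewrite (@fsumE _ A)//; last first.
  move=> x /=; apply: contraPP => nF.
  rewrite big1 ?eqxx// => i _; apply/eqP/negP => /negP Fi.
  by apply: nF; exists i.
rewrite fsbig_finite// exchange_big/=; apply: eq_bigr => i _.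
by rewrite (@fsumE _ A)// ?fsbig_finite// => x; exists i.
Qed.

Lemma le_fsum f g : fsupp f -> fsupp g -> (forall x, f x <= g x) ->
  \sum_(x \in [set: T]) f x <= \sum_(x \in [set: T]) g x.
Proof.
move=> ff fg fgle; rewrite -subr_ge0 -fsumN -fsumD//.
  by apply: fsumr_ge0 => x _; rewrite subr_ge0.
by apply: fsupp_sub ff _ => x ->; rewrite oppr0.
Qed.

End FiniteSums.

(** * Translations, the Laplacian and its symmetry *)

Section Translation.
Variables (R : realType) (d : nat).
Implicit Types f g v : 'rV[int]_d -> R.

Lemma fsupp_translate (V : nmodType) (f : 'rV[int]_d -> V) a :
  fsupp f -> fsupp (fun n => f (n + a)).
Proof.
move=> ff; apply: (@sub_finite_set _ _
  ((fun n => n - a) @` [set n | f n != 0])); last exact: finite_image.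
by move=> n /= fn; exists (n + a) => //; rewrite addrK.
Qed.

Lemma fsum_translate f a :
  \sum_(n \in [set: 'rV[int]_d]) f (n + a) = \sum_(n \in [set: 'rV[int]_d]) f n.
Proof.
rewrite [RHS](reindex_fsbigT (fun n => n + a))//.
by exists (fun n => n - a) => n; rewrite ?addrK ?subrK.
Qed.

Lemma fsum_translate_sub f a : fsupp f ->
  \sum_(n \in [set: 'rV[int]_d]) (f n - f (n + a)) = 0.
Proof.
move=> ff; rewrite fsumD// ?fsumN ?fsum_translate ?subrr//.
by apply: fsupp_sub (fsupp_translate a ff) _ => n ->; rewrite oppr0.
Qed.

Definition rlap f : 'rV[int]_d -> R := fun n => \sum_(j < d)
  (2 * f n - f (n - delta_mx 0 j) - f (n + delta_mx 0 j)).

(** The integrand is a discrete divergence: in each direction [e_j] it is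
    [K_j(n) - K_j(n + e_j)], where [K_j(n) = v(n) g(n - e_j) - g(n) v(n - e_j)]
    is a Wronskian. *)
Lemma green_identity g v : fsupp v ->
  fsupp (fun n => g n * rlap v n - v n * rlap g n) /\
  \sum_(n \in [set: 'rV[int]_d]) (g n * rlap v n - v n * rlap g n) = 0.
Proof.
move=> fv.
pose K (j : 'I_d) n :=
  v n * g (n - delta_mx 0 j) - g n * v (n - delta_mx 0 j).
have fK j : fsupp (K j).
  apply: fsuppD; first by apply: fsupp_sub fv _ => n ->; rewrite mul0r.
  apply: fsupp_sub (fsupp_translate (- delta_mx 0 j) fv) _ => n ->.
  by rewrite mulr0 oppr0.
have KE n : g n * rlap v n - v n * rlap g n =
    \sum_j (K j n - K j (n + delta_mx 0 j)).
  rewrite /rlap !mulr_sumr -sumrB; apply: eq_bigr => j _.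
  by rewrite /K addrK; ring.
have fKs j : fsupp (fun n => K j n - K j (n + delta_mx 0 j)).
  apply: fsuppD => //.
  apply: fsupp_sub (fsupp_translate (delta_mx 0 j) (fK j)) _ => n ->.
  by rewrite oppr0.
split; first by apply: fsupp_sub (fsupp_sum fKs) _ => n; rewrite KE.
under eq_fsbigr do rewrite KE.
by rewrite fsum_sum// big1// => j _; rewrite fsum_translate_sub.
Qed.

End Translation.

(** * The modulus of a complex function and the Laplacian *)

Section Modulus.
Variable R : realType.

Lemma normc_ge0 (z : R[i]) : 0 <= Normc.normc z.
Proof. by case: z => a b; apply: sqrtr_ge0. Qed.

Lemma normc_sum (I : finType) (F : I -> R[i]) :
  Normc.normc (\sum_i F i) <= \sum_i Normc.normc (F i).
Proof.
elim/big_rec2 : _ => [|i y x _ IH]; first by rewrite Normc.normc0.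
by apply: le_trans (le_normcD _ _) _; rewrite lerD2l.
Qed.

Lemma normc_double (z : R[i]) : Normc.normc (2 * z) = 2 * Normc.normc z.
Proof. by rewrite !mulr_natl normcMn. Qed.

Variable d : nat.
Implicit Types u : 'rV[int]_d -> R[i].

(** The triangle inequality applied to
    [2d u(n) = Lap u(n) + sum of u over the neighbours of n]. *)
Lemma rlap_normc_le u n :
  rlap (fun m => Normc.normc (u m)) n <= Normc.normc (lap u n).
Proof.
have E : \sum_(j < d) 2 * u n = lap u n +
    \sum_(j < d) (u (n - delta_mx 0 j) + u (n + delta_mx 0 j)).
  by rewrite /lap -big_split/=; apply: eq_bigr => j _; ring.
have H : \sum_(j < d) 2 * Normc.normc (u n) = Normc.normc (\sum_(j < d) 2 * u n).
  by rewrite !sumr_const normcMn normc_double.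
have S : \sum_(j < d) 2 * Normc.normc (u n) <= Normc.normc (lap u n) +
   \sum_(j < d) (Normc.normc (u (n - delta_mx 0 j)) +
                 Normc.normc (u (n + delta_mx 0 j))).
  rewrite H E; apply: le_trans (le_normcD _ _) _; rewrite lerD2l.
  apply: le_trans (normc_sum _) _; apply: ler_sum => j _.
  exact: le_normcD.
move: S; rewrite -lerBlDr -sumrB /rlap => S; apply: le_trans S.
by apply: ler_sum => j _; rewrite opprD addrA.
Qed.

(** For real [f], [2 f Lap f - Lap (f^2)] is the sum of the squares
    [(f(n) - f(m))^2] over the neighbours [m] of [n]; take [f = |u|] and use
    [Lap |u| <= |Lap u|]. *)
Lemma kato u n : rlap (fun m => Normc.normc (u m) ^+ 2) n <=
  2 * (Normc.normc (u n) * Normc.normc (lap u n)).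
Proof.
apply: (@le_trans _ _
  (2 * (Normc.normc (u n) * rlap (fun m => Normc.normc (u m)) n))); last first.
  by rewrite ler_pM2l ?ltr0n// ler_wpM2l ?normc_ge0 ?rlap_normc_le.
rewrite /rlap !mulr_sumr; apply: ler_sum => j _.
set a := Normc.normc (u n); set b := Normc.normc _; set c := Normc.normc _.
have := sqr_ge0 (a - b); have := sqr_ge0 (a - c); nra.
Qed.

Lemma sqr_sum_le (F : 'I_d -> R) :
  (\sum_j F j) ^+ 2 <= d%:R * \sum_j F j ^+ 2.
Proof.
rewrite -(@ler_pM2l _ 2)//.
have -> : 2 * (d%:R * \sum_j F j ^+ 2) =
    \sum_(i < d) \sum_(j < d) (F i ^+ 2 + F j ^+ 2).
  under [RHS]eq_bigr do rewrite big_split/= sumr_const card_ord.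
  rewrite big_split/= sumr_const card_ord sumrMnl !mulr_natl.
  by rewrite mulr2n.
rewrite expr2 mulr_suml mulr_sumr.
apply: ler_sum => i _; rewrite !mulr_sumr; apply: ler_sum => j _.
have := sqr_ge0 (F i - F j); nra.
Qed.

(** Bound [|Lap u|] by the sum of the [d] terms
    [2 |u(n)| + |u(n - e_j)| + |u(n + e_j)|]; Cauchy-Schwarz over [j] costs
    [d], over the three summands [3], and each direction then contributes
    [4 + 1 + 1] copies of the norm. *)
Lemma lap_l2_bound u : finitely_supported u ->
  \sum_(n \in [set: 'rV[int]_d]) Normc.normc (lap u n) ^+ 2 <=
  18 * d%:R ^+ 2 * \sum_(n \in [set: 'rV[int]_d]) Normc.normc (u n) ^+ 2.
Proof.
move=> fu; pose v n := Normc.normc (u n) ^+ 2.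
have fv : fsupp v.
  by apply: fsupp_sub fu _ => n; rewrite /v => ->; rewrite Normc.normc0 expr0n.
pose G (j : 'I_d) n :=
  4 * v n + (v (n + - delta_mx 0 j) + v (n + delta_mx 0 j)).
have f4 : fsupp (fun n => 4 * v n).
  by apply: fsupp_sub fv _ => n ->; rewrite mulr0.
have ft a : fsupp (fun n => v (n + a)) by apply: fsupp_translate.
have fG j : fsupp (G j) by do 2?[apply: fsuppD => //].
have GE j : \sum_(n \in [set: 'rV[int]_d]) G j n =
    6 * \sum_(n \in [set: 'rV[int]_d]) v n.
  rewrite /G fsumD//; last exact: fsuppD.
  rewrite fsumD// !fsum_translate -mulr_fsumr; ring.
have -> : 18 * d%:R ^+ 2 * \sum_(n \in [set: 'rV[int]_d]) v n =
    \sum_(n \in [set: 'rV[int]_d]) 3 * d%:R * \sum_j G j n.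
  rewrite -mulr_fsumr fsum_sum// (eq_bigr _ (fun j _ => GE j)).
  by rewrite sumr_const card_ord -mulr_natl; ring.
apply: le_fsum.
- apply: fsupp_sub (finitely_supported_lap fu) _ => n ->.
  by rewrite Normc.normc0 expr0n.
- by apply: fsupp_sub (fsupp_sum fG) _ => n ->; rewrite mulr0.
move=> n; pose b (j : 'I_d) := 2 * Normc.normc (u n) +
  (Normc.normc (u (n - delta_mx 0 j)) + Normc.normc (u (n + delta_mx 0 j))).
have lb : Normc.normc (lap u n) <= \sum_j b j.
  rewrite /lap; apply: le_trans (normc_sum _) _; apply: ler_sum => j _.
  rewrite -addrA -opprD; apply: le_trans (le_normcD _ _) _.
  by rewrite normcN normc_double lerD2l; apply: le_normcD.
apply: (@le_trans _ _ ((\sum_j b j) ^+ 2)).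
  by rewrite lerXn2r// nnegrE ?normc_ge0//; apply: le_trans lb; apply: normc_ge0.
apply: le_trans (sqr_sum_le _) _.
rewrite (mulrC 3) -mulrA ler_wpM2l ?ler0n// mulr_sumr.
apply: ler_sum => j _; rewrite /b /G /v.
set x := Normc.normc (u n); set y := Normc.normc _; set z := Normc.normc _.
have := sqr_ge0 (y - z); have := sqr_ge0 (2 * x - y).
have := sqr_ge0 (2 * x - z); nra.
Qed.

End Modulus.

(** * Superharmonicity of the weights *)

Section Weight.
Variable R : realType.

(** A Taylor bound that is uniform for [|e| <= 1/2]. The constant [4 ^ p]
    is chosen for the induction: multiplying by [z = 1 / (1 + e) <= 2] turns a
    constant [C] into [z (1 + p + C) <= 2 (1 + p + C) <= 4 C]. *)
Lemma inv_pow_le (p : nat) (e : R) : `|e| <= 2^-1 ->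
  (1 + e)^-1 ^+ p <= 1 - p%:R * e + 4 ^+ p * e ^+ 2.
Proof.
rewrite ler_norml => /andP[e1 e2].
have p0 : 0 < 1 + e by lra.
set z := (1 + e)^-1.
have z0 : 0 <= z by rewrite invr_ge0 ltW.
have zE : z * (1 + e) = 1 by rewrite mulVf// gt_eqF.
have z2 : z <= 2 by nra.
elim: p => [|p IH]; first by rewrite !expr0; have := sqr_ge0 e; lra.
rewrite exprS; apply: le_trans (ler_wpM2l z0 IH) _.
have p4 : 1 + p%:R <= 4 ^+ p :> R by rewrite addrC natr1 -natrX ler_nat ltn_expl.
(* the two sides differ by a multiple of z (1 + e) - 1 = 0 *)
have -> : z * (1 - p%:R * e + 4 ^+ p * e ^+ 2) =
    1 - (p%:R + 1) * e + z * (e ^+ 2 * (1 + p%:R + 4 ^+ p)).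
  apply/eqP; rewrite -subr_eq0; apply/eqP.
  transitivity ((z * (1 + e) - 1) * (1 - e - p%:R * e)); first by ring.
  by rewrite zE subrr mul0r.
rewrite -[p.+1%:R]natr1 (exprS 4) lerD2l.
have e0 : 0 <= e ^+ 2 by apply: sqr_ge0.
apply: le_trans (ler_wpM2r _ z2) _.
  by rewrite mulr_ge0// addr_ge0// ?exprn_ge0// -(natrD _ 1) ler0n.
move: (4 ^+ p) p4 => C p4; have := ler_wpM2l e0 p4; nra.
Qed.

Definition nsq d (n : 'rV[int]_d) : R := \sum_(j < d) ((n 0 j)%:~R : R) ^+ 2.

(** The shift [s] keeps the weight bounded by [1/s], which is what makes the
    relative change of the weight between neighbours small everywhere,
    including near the origin. *)
Definition weight d (s : R) (n : 'rV[int]_d) : R := (s + nsq n)^-1.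

Lemma nsq_ge0 d (n : 'rV[int]_d) : 0 <= nsq n.
Proof. by apply: sumr_ge0 => j _; apply: sqr_ge0. Qed.

Lemma sqr_coord_le_nsq d (n : 'rV[int]_d) j : ((n 0 j)%:~R : R) ^+ 2 <= nsq n.
Proof.
rewrite /nsq (bigD1 j)//= lerDl.
by apply: sumr_ge0 => i _; apply: sqr_ge0.
Qed.

Lemma nsq_neighbor d (n : 'rV[int]_d) (j : 'I_d) (c : int) :
  nsq (n + c *: delta_mx 0 j) =
  nsq n + (2 * c%:~R * (n 0 j)%:~R + c%:~R ^+ 2).
Proof.
rewrite /nsq (bigD1 j)//= [in RHS](bigD1 j)//=.
have -> : \sum_(i < d | i != j)
    (((n + c *: delta_mx 0 j) 0 i)%:~R : R) ^+ 2 =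
  \sum_(i < d | i != j) ((n 0 i)%:~R : R) ^+ 2.
  by apply: eq_bigr => i /negbTE ij; rewrite !mxE ij andbF mulr0 addr0.
by rewrite !mxE !eqxx mulr1 intrD; ring.
Qed.

Lemma weight_gt0 d s (n : 'rV[int]_d) : 0 < s -> 0 < weight s n.
Proof. by move=> s0; rewrite invr_gt0 ltr_wpDr ?nsq_ge0. Qed.

(** Passing from [n] to [n + c e_j] with [c = 1] or [-1] multiplies [1/w] by
    [1 + e] with [e = (1 + 2 c n_j) w], and [|e| <= 1/2]. In the expansion of
    [(1 + e)^(-p)] the linear terms [2 c n_j w] of the two opposite neighbours
    cancel and leave [-2pw] per direction, while the quadratic terms sum to
    [4^p w^2 (2d + 8 |n|^2)]. Since [w <= 1/s] and [w |n|^2 <= 1], the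
    lower bounds on [s] and [d] make this at most [d w]; and [2p d w - d w >= d w]. *)
Lemma weight_superharmonic d (p : nat) (s : R) (n : 'rV[int]_d) :
  (0 < p)%N -> 4 ^+ p.+1 <= s -> 4 ^+ p.+2 <= d%:R :> R ->
  d%:R * weight s n ^+ p.+1 <= rlap (fun m => weight s m ^+ p) n.
Proof.
move=> p0 s4 d4.
have p4 : 4 <= 4 ^+ p :> R.
  by case: p p0 {s4 d4} => // p _; rewrite exprS ler_peMr// exprn_ege1// ler1n.
have {}s4 : 4 * 4 ^+ p <= s by rewrite -exprS.
have {}d4 : 16 * 4 ^+ p <= d%:R :> R.
  by move: d4; rewrite !exprS mulrA -natrM.
have s0 : 0 < s by lra.
set w := weight s n; have w0 : 0 < w by apply: weight_gt0.
have wE : w * (s + nsq n) = 1 by rewrite mulVf// gt_eqF// ltr_wpDr ?nsq_ge0.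
pose e (j : 'I_d) (c : int) := (2 * c%:~R * (n 0 j)%:~R + 1) * w.
have near (j : 'I_d) (c : int) : c ^+ 2 = 1 ->
  weight s (n + c *: delta_mx 0 j) ^+ p <=
  w ^+ p * (1 - p%:R * e j c + 4 ^+ p * e j c ^+ 2).
  move=> c1.
  have c1R : (c%:~R : R) ^+ 2 = 1 by rewrite -rmorphXn c1.
  have -> : weight s (n + c *: delta_mx 0 j) = w * (1 + e j c)^-1.
    rewrite /weight nsq_neighbor c1R -[w]invrK -invfM; congr (_^-1).
    rewrite /w /weight invrK /e -/w.
    by rewrite mulrDr mulr1 mulrCA [_ * w]mulrC wE; ring.
  rewrite exprMn ler_pM2l ?exprn_gt0//; apply: inv_pow_le.
  rewrite /e normrM (gtr0_norm w0) -ler_pdivlMr// /w /weight invrK.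
  have nj := sqr_coord_le_nsq n j.
  set x := (n 0 j)%:~R in nj *.
  have cN : `|c%:~R : R| = 1.
    by apply/eqP; rewrite -(@eqrXn2 _ 2)// expr1n -normrX c1R normr1.
  apply: le_trans (ler_normD _ _) _.
  rewrite !normrM cN normr1 mulr1 (@ger0_norm _ 2)//.
  (* 2 (1 + 2 |x|) <= 6 + x^2, and s >= 6 *)
  have := sqr_ge0 (`|x| - 2); rewrite -(real_normK (num_real x)) in nj.
  nra.
have sum_near : \sum_(j < d) w ^+ p *
    (2 * p%:R * w - 4 ^+ p * w ^+ 2 * (2 + 8 * (n 0 j)%:~R ^+ 2)) <=
  rlap (fun m => weight s m ^+ p) n.
  apply: ler_sum => j _; rewrite -/w.
  have n1 := near j 1 (expr1n _ _); rewrite scale1r in n1.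
  have nN1 := near j (-1) (sqrrN 1); rewrite scaleN1r in nN1.
  apply: le_trans (lerB (lerB (lexx _) nN1) n1).
  by rewrite le_eqVlt /e mulrN1z; apply/orP; left; apply/eqP; ring.
apply: le_trans sum_near; rewrite -mulr_sumr exprSr mulrCA ler_pM2l ?exprn_gt0//.
have -> : \sum_(j < d)
    (2 * p%:R * w - 4 ^+ p * w ^+ 2 * (2 + 8 * (n 0 j)%:~R ^+ 2)) =
  w * (2 * p%:R * d%:R - 4 ^+ p * w * (2 * d%:R + 8 * nsq n)).
  rewrite sumrB -[X in _ - X]mulr_sumr big_split/= -mulr_sumr !sumr_const card_ord.
  by rewrite -mulr_sumr -/(nsq n) -[w *+ d]mulr_natl -[2 *+ d]mulr_natl; ring.
rewrite mulrC ler_pM2l//.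
have p1 : 1 <= p%:R :> R by rewrite ler1n.
have pd : d%:R <= p%:R * d%:R :> R by rewrite ler_peMl ?ler0n.
have q0 := nsq_ge0 n.
move: (4 ^+ p) p4 s4 d4 => C p4 s4 d4.
have wq : w * nsq n <= 1 by nra.
have wC : 4 * (C * w) <= 1 by nra.
have wCd : 4 * (C * w) * d%:R <= d%:R.
  by rewrite ler_piMl ?ler0n.
have Cwq : C * (w * nsq n) <= C by rewrite ler_piMr//; lra.
nra.
Qed.

(** * The weighted Rellich inequality and its iteration *)

(** With [lambda = d/2], [P = w^a |Lap u|] and [Q = w^(a+1) |u|], the
    inequality [0 <= (P - lambda Q)^2] and the superharmonicity of
    [g = w^(2a+1)] give, at every point,
      [lambda^2 Q^2 + lambda (g Lap |u|^2 - |u|^2 Lap g) <= P^2],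
    where the middle term has sum zero by Green's identity. *)
Lemma weighted_rellich d (a : nat) (s : R) (u : 'rV[int]_d -> R[i]) :
  4 ^+ (2 * a).+2 <= s -> 4 ^+ (2 * a).+3 <= d%:R :> R ->
  finitely_supported u ->
  (d%:R / 2) ^+ 2 * \sum_(n \in [set: 'rV[int]_d])
     weight s n ^+ (2 * a).+2 * Normc.normc (u n) ^+ 2 <=
  \sum_(n \in [set: 'rV[int]_d])
     weight s n ^+ (2 * a) * Normc.normc (lap u n) ^+ 2.
Proof.
move=> s4 d4 fu.
have s0 : 0 < s by apply: lt_le_trans s4; rewrite exprn_gt0.
pose v n : R := Normc.normc (u n) ^+ 2.
have v0 n : u n = 0 -> v n = 0 by rewrite /v => ->; rewrite Normc.normc0 expr0n.
have fv : fsupp v by apply: fsupp_sub fu v0.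
pose g (n : 'rV[int]_d) : R := weight s n ^+ (2 * a).+1.
have [fG G0] := green_identity g fv.
pose h n := d%:R / 2 * (g n * rlap v n - v n * rlap g n).
have fh : fsupp h by apply: fsupp_sub fG _ => n; rewrite /h => ->; rewrite mulr0.
have h0 : \sum_(n \in [set: 'rV[int]_d]) h n = 0.
  by rewrite /h -mulr_fsumr G0 mulr0.
pose b n := (d%:R / 2) ^+ 2 * (weight s n ^+ (2 * a).+2 * v n).
have fb : fsupp b.
  by apply: fsupp_sub fv _ => n; rewrite /b => ->; rewrite !mulr0.
apply: (@le_trans _ _ (\sum_(n \in [set: 'rV[int]_d]) (b n + h n))).
  by rewrite fsumD// h0 addr0 /b -mulr_fsumr.
apply: le_fsum; first exact: fsuppD.
  apply: fsupp_sub (finitely_supported_lap fu) _ => n ->.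
  by rewrite Normc.normc0 expr0n mulr0.
move=> n.
have w0 := weight_gt0 n s0.
have K := kato u n.
have L : d%:R * weight s n ^+ (2 * a).+2 <= rlap g n.
  exact: weight_superharmonic.
have {}L : v n * (d%:R * weight s n ^+ (2 * a).+2) <= v n * rlap g n.
  by rewrite ler_wpM2l ?exprn_ge0 ?normc_ge0.
have {}K : g n * rlap v n <=
    g n * (2 * (Normc.normc (u n) * Normc.normc (lap u n))).
  by apply: ler_wpM2l => //; apply/exprn_ge0/ltW.
have := sqr_ge0 (weight s n ^+ a * Normc.normc (lap u n) -
   d%:R / 2 * (weight s n ^+ a.+1 * Normc.normc (u n))).
have d0 : 0 <= d%:R :> R by [].
move: K L; rewrite /b /h /v /g.
rewrite [(2 * a)%N]mulnC ![weight s n ^+ _.+1]exprS !exprM.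
set A := Normc.normc (u n); set B := Normc.normc (lap u n).
move: (weight s n) (weight s n ^+ a) => w W.
set X := rlap _ _; set Y := rlap _ _ => K L.
have {}K := ler_wpM2l d0 K; have {}L := ler_wpM2l d0 L.
nra.
Qed.

Lemma lap_energyS d k (u : 'rV[int]_d -> R[i]) :
  lap_energy k.+1 u = lap_energy k (lap u).
Proof. by apply: eq_fsbigr => n _; rewrite /iter_lap iterSr. Qed.

Lemma iterated_rellich d (a : nat) (s : R) (u : 'rV[int]_d -> R[i]) :
  4 ^+ (2 * a) <= s -> 4 ^+ (2 * a).+1 <= d%:R :> R ->
  finitely_supported u ->
  (d%:R / 2) ^+ (2 * a) * \sum_(n \in [set: 'rV[int]_d])
     weight s n ^+ (2 * a) * Normc.normc (u n) ^+ 2 <=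
  lap_energy a u.
Proof.
elim: a u => [|a IH] u s4 d4 fu.
  by rewrite muln0 mul1r; under eq_fsbigr do rewrite mul1r.
rewrite mulnS in s4 d4 *.
have le4 m : 4 ^+ m <= 4 ^+ m.+2 :> R by rewrite ler_weXn2l// ?ler1n// leqW.
have IHl := IH (lap u) (le_trans (le4 _) s4) (le_trans (le4 _) d4)
  (finitely_supported_lap fu).
rewrite lap_energyS; apply: le_trans IHl.
rewrite addnC exprD -mulrA ler_wpM2l//.
  by rewrite exprn_ge0// divr_ge0.
by rewrite addn2; apply: weighted_rellich.
Qed.

End Weight.

(** * Bounds on the Hardy-Rellich constants *)

(** The largest exponent used in the iteration is [2k - 1], for which
    superharmonicity requires [s >= 4^(2k)] and [d >= 4^(2k+1)]. *)
Lemma hardy_rellich_lower (R : realType) (k d : nat) :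
  4 ^+ (2 * k).+1 <= d%:R :> R ->
  hardy_rellich k d ((2 * (4 ^+ (2 * k) + 1))^-1 ^+ (2 * k) * d%:R ^+ (2 * k) : R).
Proof.
move=> d4 u fu u0; pose s : R := 4 ^+ (2 * k).
have s0 : 0 < s by rewrite exprn_gt0.
apply: le_trans (iterated_rellich (lexx _) d4 fu).
rewrite -/s (_ : (2 * (s + 1))^-1 ^+ (2 * k) * d%:R ^+ (2 * k) =
    (d%:R / 2) ^+ (2 * k) * (s + 1)^-1 ^+ (2 * k)); last first.
  by rewrite -!exprMn invfM; congr (_ ^+ _); ring.
rewrite -mulrA ler_wpM2l ?exprn_ge0 ?divr_ge0// mulr_fsumr.
apply: le_fsum.
- by apply: fsupp_sub (finite_support_weighted_norm k fu) _ => n ->; rewrite mulr0.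
- by apply: fsupp_sub fu _ => n ->; rewrite Normc.normc0 expr0n mulr0.
move=> n; have [->|n0] := eqVneq n 0.
  by rewrite u0 Normc.normc0 expr0n !mul0r !mulr0.
rewrite mulrCA mulrC ler_wpM2r ?sqr_ge0//.
have nE : enorm R n ^+ (4 * k) = nsq R n ^+ (2 * k).
  have -> : (4 * k = 2 * (2 * k))%N by rewrite mulnA.
  by rewrite exprM sqr_sqrtr ?nsq_ge0.
have n1 : 1 <= nsq R n.
  have /existsP[j nj] : [exists j, n 0 j != 0].
    apply: contraNT n0; rewrite negb_exists => /forallP h.
    by apply/eqP/rowP => j; rewrite mxE; apply/eqP; have := h j; rewrite negbK.
  apply: le_trans (sqr_coord_le_nsq R n j).
  rewrite -rmorphXn ler1z -gtz0_ge1 lt_neqAle sqr_ge0 andbT eq_sym.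
  by rewrite expf_neq0.
have q0 : 0 < nsq R n by apply: lt_le_trans n1.
rewrite nE -exprVn -exprMn lerXn2r ?nnegrE//.
- by rewrite mulr_ge0// invr_ge0 ?addr_ge0 ?nsq_ge0// ltW.
- by rewrite ltW ?weight_gt0.
rewrite -invfM lef_pV2 ?posrE ?mulr_gt0 ?addr_gt0//; nra.
Qed.

Lemma lap_energy_le (R : realType) (k d : nat) (u : 'rV[int]_d -> R[i]) :
  finitely_supported u ->
  lap_energy k u <= 18 ^+ k * d%:R ^+ (2 * k) *
    \sum_(n \in [set: 'rV[int]_d]) Normc.normc (u n) ^+ 2.
Proof.
elim: k u => [|k IH] u fu; first by rewrite muln0 !mul1r.
rewrite lap_energyS; apply: le_trans (IH _ (finitely_supported_lap fu)) _.
rewrite mulnS addnC exprD exprSr.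
have -> : 18 ^+ k * 18 * (d%:R ^+ (2 * k) * d%:R ^+ 2) =
  18 ^+ k * d%:R ^+ (2 * k) * (18 * d%:R ^+ 2) :> R by ring.
rewrite -[leRHS]mulrA ler_wpM2l ?mulr_ge0 ?exprn_ge0//.
exact: lap_l2_bound.
Qed.

Lemma hardy_rellich_upper (R : realType) (k d : nat) (C : R) : (0 < d)%N ->
  hardy_rellich k d C -> C <= 18 ^+ k * d%:R ^+ (2 * k).
Proof.
case: d => // d _ hC.
pose e : 'rV[int]_d.+1 := delta_mx 0 0.
pose u (n : 'rV[int]_d.+1) : R[i] := if n == e then 1 else 0.
have uE n : n <> e -> u n = 0 by move=> /eqP/negbTE; rewrite /u => ->.
have ue : Normc.normc (u e) ^+ 2 = 1 by rewrite /u eqxx Normc.normc1 expr1n.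
have e0 : 0 <> e by move/matrixP => /(_ 0 0); rewrite !mxE.
have fu : finitely_supported u.
  apply: (@sub_finite_set _ _ [set e]) => [n /=|]; last exact: finite_set1.
  by apply: contraPP => /uE ->; rewrite eqxx.
have ee : enorm R e = 1.
  rewrite /enorm (bigD1 0)//= big1 => [|j /negbTE j0].
    by rewrite mxE !eqxx addr0 expr1n sqrtr1.
  by rewrite mxE j0 andbF expr0n.
have single (F : 'rV[int]_d.+1 -> R) : (forall n, u n = 0 -> F n = 0) ->
    \sum_(n \in [set: 'rV[int]_d.+1]) F n = F e.
  move=> F0; rewrite -(fsbig_widen [set e])// ?fsbig_set1//.
  by move=> n [_ /= /uE/F0].
have := hC u fu (uE _ e0).
rewrite /weighted_norm single => [|n ->]; last first.
  by rewrite Normc.normc0 expr0n mul0r.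
rewrite ue ee expr1n divr1 mulr1 => /le_trans; apply.
have := lap_energy_le k fu.
by rewrite single ?ue ?mulr1// => n ->; rewrite Normc.normc0 expr0n.
Qed.

Theorem theorem1p2 (R : realType) (k : nat) (hk : (1 <= k)%N) :
  exists (c1 c2 : R) (N : nat),
    [/\ 0 < c1, 0 < c2, (0 < N)%N &
      forall d : nat, (N <= d)%N ->
        c1 * d%:R ^+ (2 * k) <= sharp_const R k d /\
        sharp_const R k d <= c2 * d%:R ^+ (2 * k)].
Proof.
exists ((2 * (4 ^+ (2 * k) + 1))^-1 ^+ (2 * k)), (18 ^+ k), (4 ^ (2 * k).+1)%N.
split; rewrite ?exprn_gt0 ?invr_gt0 ?mulr_gt0 ?addr_gt0 ?exprn_gt0 ?expn_gt0//.
move=> d dN.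
have d0 : (0 < d)%N by apply: leq_trans dN; rewrite expn_gt0.
have [sharp sharp_max] := sharp_const_max R k d0.
split; last exact: hardy_rellich_upper.
by apply/sharp_max/hardy_rellich_lower; rewrite -natrX ler_nat.
Qed.
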